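(* Let $C$ be an infinite set of natural numbers, let $R\subseteq\mathbb{N}$ be a set of measurable recurrence and let $A\subseteq\mathbb{N}$ satisfy $d^*(A)>0$. Then there exist $r\in R$ and $B\subseteq C$ such that $$\overline{d}_C(B):=\limsup_{N\to\infty}\frac{|B\cap\{1,\dots,N\}|}{|C\cap\{1,\dots,N\}|}>0$$ and $r(B+B)\subseteq A-A$.
   Context: A set $R\subseteq\mathbb{N}$ (positive integers) is a set of measurable recurrence if, for every probability space $(X,\mathcal{B},\mu)$ with an invertible measure-preserving transformation $T$ (i.e. every measure preserving $\mathbb{Z}$-action $(T^n)_{n\in\mathbb{Z}}$) and every $Y\in\mathcal{B}$ with $\mu(Y)>0$, there exists $r\in R$ such that $\mu(Y\cap T^{-r}Y)>0$. The upper Banach density of $A\subseteq\mathbb{Z}$ is $d^*(A)=\sup_{(I_N)}\limsup_{N\to\infty}\frac{|A\cap I_N|}{|I_N|}$, where $(I_N)$ ranges over all sequences of intervals $I_N=[a_N,b_N]\cap\mathbb{Z}$ with $\lim_N(b_N-a_N)=\infty$. $r(B+B)=\{r(b+b'):b,b'\in B\}$ and $A-A=\{a-a':a,a'\in A\}$. *)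

(* Defs.v *)
From HB Require Import structures.
From mathcomp Require Import all_boot all_order all_algebra finmap.
From mathcomp Require Import all_classical all_reals all_analysis.

Set Implicit Arguments.
Unset Strict Implicit.
Unset Printing Implicit Defensive.

Import Order.TTheory GRing.Theory Num.Theory.
Import numFieldNormedType.Exports.

Local Open Scope classical_set_scope.
Local Open Scope ring_scope.

Definition positive_naturals (S : set nat) : Prop :=
  forall n, S n -> (0 < n)%N.

(* [fset_set] sends an infinite set to the empty one, so this is the cardinality
   only for finite sets; it is only used on subsets of [int_itv a b] and of
   [initial_segment N]. *)
Definition card_fin (T : choiceType) (A : set T) : nat := #|` fset_set A|%fset.

Definition int_itv (a b : int) : set int := [set n | a <= n <= b].

Definition initial_segment (N : nat) : set nat := [set n | (1 <= n <= N)%N].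

Lemma finite_initial_segment (N : nat) : finite_set (initial_segment N).
Proof.
apply: (@sub_finite_set _ _ `I_N.+1) => // n /= /andP[_ nN].
by rewrite ltnS.
Qed.

Lemma finite_int_itv (a b : int) : finite_set (int_itv a b).
Proof.
apply: (@sub_finite_set _ _ ((fun n : nat => a + n%:Z) @` `I_(`|b - a|.+1))).
  move=> n /= /andP[an nb]; exists `|n - a|%N; last first.
    by rewrite gez0_abs ?subr_ge0// [a + _]addrC subrK.
  rewrite /mkset ltnS -lez_nat !gez0_abs ?subr_ge0 ?(le_trans an nb)//.
  exact: lerB.
exact/finite_image/finite_II.
Qed.

Definition upper_banach_density (R : realType) (A : set int) : \bar R :=
  ereal_sup [set d | exists a b : nat -> int,
    ((b N - a N)%:~R : R) @[N --> \oo] --> +oo /\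
    d = limn_esup (fun N =>
          ((card_fin (A `&` int_itv (a N) (b N)))%:R
           / (card_fin (int_itv (a N) (b N)))%:R : R)%:E)].

(* Meant for [B `<=` C] with C infinite and positive: the quotient is then 0/0 = 0
   for the finitely many N below the least element of C, which the limsup
   ignores. *)
Definition upper_relative_density (R : realType) (C B : set nat) : \bar R :=
  limn_esup (fun N =>
    ((card_fin (B `&` initial_segment N))%:R
     / (card_fin (C `&` initial_segment N))%:R : R)%:E).

Definition measure_preserving (R : realType) (d : measure_display)
    (X : measurableType d) (mu : probability X R) (T : X -> X) : Prop :=
  measurable_fun setT T /\
  forall Y : set X, measurable Y -> mu (T @^-1` Y) = mu Y.

(* Measurability of the inverse is part of the definition; that the inverse
   preserves the measure then follows. *)
Definition invertible_measure_preserving (R : realType) (d : measure_display)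
    (X : measurableType d) (mu : probability X R) (T : X -> X) : Prop :=
  measure_preserving mu T /\
  exists T' : X -> X,
    [/\ cancel T T', cancel T' T & measurable_fun setT T'].

Definition measurable_recurrence (R : realType) (S : set nat) : Prop :=
  positive_naturals S /\
  forall (d : measure_display) (X : measurableType d) (mu : probability X R)
    (T : X -> X), invertible_measure_preserving mu T ->
  forall Y : set X, measurable Y -> (0 < mu Y)%E ->
  exists2 r : nat, S r & (0 < mu (Y `&` iter r T @^-1` Y))%E.

Definition scaled_sumset (r : nat) (B : set nat) : set nat :=
  [set (r * (b + b'))%N | b in B & b' in B].

Definition difference_set (A : set nat) : set int :=
  [set a%:Z - a'%:Z | a in A & a' in A].

(* Main.v *)
Require Import Defs.
From HB Require Import structures.
From mathcomp Require Import all_boot all_order all_algebra finmap.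
From mathcomp Require Import all_classical all_reals all_analysis.
From mathcomp Require Import zify lra.

Set Implicit Arguments.
Unset Strict Implicit.
Unset Printing Implicit Defensive.

Import Order.TTheory GRing.Theory Num.Theory.
Import numFieldNormedType.Exports.

Local Open Scope classical_set_scope.
Local Open Scope ring_scope.

(** Write [A] also for its image in the integers, and [C_N] for the part of [C]
    up to [N].  Suppose that for some [r] in [S] a single two-sided 0-1 sequence
    [x] is a pointwise limit of translates of the indicator of [A] and satisfies
    [x (r c) = x (- r c) = 1] for a set [B] of [c] in [C] of positive upper
    relative density.  For [b], [b'] in [B] some translate [A - n] agrees with
    [x] at [r b] and at [- r b'], so [n + r b] and [n - r b'] lie in [A] and
    their difference is [r (b + b')].

    To find [r] and [x], start from a translation-invariant mean [l] on the
    integers with [l A > 0], an ultrafilter limit of averages over intervals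
    ([banach_mean]).  The number
      [phi r = lim_N avg_(c in C_N) l (A `&` (A - 2 c r))]
    measures how often [r] works on average over [C].  Although [C] may be very
    sparse, [phi] is the correlation sequence of one dynamical system: the
    limit over [N] of the averages, over [c] in [C_N], of the laws of the
    sequences [i |-> 1_A (n + 2 c i)] is a shift-invariant law on 0-1 sequences,
    because the shift on the [c]-th sequence is the translation by [2 c] of [n].
    Recurrence of that system gives [r] in [S] with [phi r > 0]
    ([averaged_recurrence]).

    Translating by [- r c], [phi r] is the limit of the averages over [c] in
    [C_N] of [l (n | n + r c and n - r c are in A)].  Let [f_N x] be the
    proportion of [c] in [C_N] with [x (r c) = x (- r c) = 1].  Under the law of
    a random translate of [A], [f_N] has expectation bounded below for
    infinitely many [N]; by Markov and sigma-additivity the event that [f_N] is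
    bounded below infinitely often has positive probability
    ([exists_limsup_point]), and almost every [x] is a limit of translates of
    [A].

    Both laws come as finitely additive means.  A mean on 0-1 sequences defines
    a probability measure since cylinders are compact ([cylinder_compact]), so
    that finite additivity on cylinders is already sigma-additivity and
    Caratheodory's extension applies ([mean_measure]). *)

(** * Finitely additive means and their ultrafilter limits *)

Section Means.
Context (R : realType).

Definition bounded_by (T : Type) (M : R) (f : T -> R) := forall x, `|f x| <= M.

(** A finitely additive probability, presented as a positive functional rather
    than as a set function so that averages of indicators can be integrated
    directly.  Only the values on bounded functions are constrained. *)
Record is_mean (T : Type) (L : (T -> R) -> R) : Prop := {
  mean_cst1 : L (cst 1) = 1;
  meanD : forall M f g, bounded_by M f -> bounded_by M g ->
    L (f \+ g) = L f + L g;
  meanZ : forall M k f, bounded_by M f -> L (fun x => k * f x) = k * L f;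
  mean_ge0 : forall M f, bounded_by M f -> (forall x, 0 <= f x) -> 0 <= L f }.

Lemma bounded_by_indic (T : Type) (E : set T) : bounded_by 1 (\1_E : T -> R).
Proof.
by move=> x; rewrite indicE; case: (_ \in _); rewrite ?normr1 ?normr0.
Qed.

Lemma bounded_by_comp (T S : Type) (h : S -> T) M (f : T -> R) :
  bounded_by M f -> bounded_by M (f \o h).
Proof. by move=> fM x; exact: fM. Qed.

Lemma bounded_by_le (T : Type) M M' (f : T -> R) :
  M <= M' -> bounded_by M f -> bounded_by M' f.
Proof. by move=> MM' fM x; exact: le_trans (fM x) MM'. Qed.

Section MeanTheory.
Context (T : Type) (L : (T -> R) -> R) (mL : is_mean L).
Implicit Types f g : T -> R.

Lemma meanB M f g : bounded_by M f -> bounded_by M g ->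
  L (fun x => f x - g x) = L f - L g.
Proof.
move=> fM gM; have gM' : bounded_by M (fun x => -1 * g x).
  by move=> x; rewrite mulN1r normrN.
rewrite -[- L g]mulN1r -(meanZ mL _ gM) -(meanD mL fM gM').
by congr L; apply/funext => x /=; rewrite mulN1r.
Qed.

Lemma mean_le M f g : bounded_by M f -> bounded_by M g ->
  (forall x, f x <= g x) -> L f <= L g.
Proof.
move=> fM gM fg; rewrite -subr_ge0 -(meanB gM fM).
apply: (mean_ge0 mL (M := M + M)) => x; last by rewrite subr_ge0.
by rewrite (le_trans (ler_normB _ _)) ?lerD.
Qed.

Lemma mean_cst k : L (cst k) = k.
Proof.
have b1 : bounded_by 1 (cst 1 : T -> R) by move=> x; rewrite normr1.
rewrite -[RHS]mulr1 -(mean_cst1 mL) -(meanZ mL k b1).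
by congr L; apply/funext => x; rewrite mulr1.
Qed.

(** A mean exists only on a nonempty type, where [M] is nonnegative; the
    absolute value in the bound saves that argument. *)
Lemma mean_norm_le M f : bounded_by M f -> `|L f| <= `|M|.
Proof.
move=> /(bounded_by_le (ler_norm M)) fM.
have Mb k : `|k| = `|M| -> bounded_by `|M| (cst k : T -> R).
  by move=> kM x; rewrite /= kM.
rewrite ler_norml; apply/andP; split.
  rewrite -[leLHS]mean_cst; apply: (mean_le (Mb _ _) fM).
    by rewrite normrN normr_id.
  by move=> x; have := fM x; rewrite ler_norml => /andP[].
rewrite -[leRHS]mean_cst; apply: (mean_le fM (Mb _ _)).
  by rewrite normr_id.
by move=> x; have := fM x; rewrite ler_norml => /andP[].
Qed.

Lemma mean_sum (I : Type) (s : seq I) M (f : I -> T -> R) :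
  (forall i, bounded_by M (f i)) ->
  L (fun x => \sum_(i <- s) f i x) = \sum_(i <- s) L (f i).
Proof.
move=> fM; elim: s => [|i s IH].
  rewrite big_nil -[RHS]mean_cst; congr L; apply/funext => x.
  by rewrite big_nil.
rewrite big_cons -IH.
rewrite -(meanD mL (M := `|M| + (size s)%:R * `|M|)).
- by congr L; apply/funext => x /=; rewrite big_cons.
- apply: bounded_by_le (fM i).
  by rewrite (le_trans (ler_norm M))// lerDl mulr_ge0.
- move=> x; apply: (@le_trans _ _ ((size s)%:R * `|M|)); last by rewrite lerDr.
  elim: s {IH} => [|j s IH]; first by rewrite big_nil normr0 mul0r.
  rewrite big_cons (le_trans (ler_normD _ _))//=.
  rewrite -natr1 mulrDl mul1r addrC lerD//.
  by rewrite (le_trans (fM j x))// ler_norm.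
Qed.

End MeanTheory.

Lemma is_mean_eval (T : Type) (x : T) : is_mean (fun f : T -> R => f x).
Proof. by split. Qed.

Lemma is_mean_comp (T S : Type) (h : S -> T) (L : (S -> R) -> R) :
  is_mean L -> is_mean (fun f : T -> R => L (f \o h)).
Proof.
move=> mL; split; first exact: mean_cst1 mL.
- move=> M f g fM gM.
  exact: (meanD mL (bounded_by_comp h fM) (bounded_by_comp h gM)).
- by move=> M k f fM; exact: (meanZ mL k (bounded_by_comp h fM)).
- by move=> M f fM f0; apply: (mean_ge0 mL (bounded_by_comp h fM)) => x /=.
Qed.

Definition avg (I : Type) (s : seq I) (f : I -> R) : R :=
  (\sum_(i <- s) f i) / (size s)%:R.

Lemma is_mean_avg (T I : Type) (s : seq I) (L : I -> (T -> R) -> R) :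
  (0 < size s)%N -> (forall i, is_mean (L i)) ->
  is_mean (fun f => avg s (fun i => L i f)).
Proof.
move=> s0 mL; rewrite /avg; split.
- under eq_bigr do rewrite (mean_cst1 (mL _)).
  by rewrite big_tnth sumr_const card_ord divff// pnatr_eq0 -lt0n.
- move=> M f g fM gM; rewrite -mulrDl -big_split /=; congr (_ / _).
  by apply: eq_bigr => i _; exact: meanD fM gM.
- move=> M k f fM; rewrite mulrA mulr_sumr; congr (_ / _).
  by apply: eq_bigr => i _; exact: meanZ fM.
- move=> M f fM f0; apply: divr_ge0 => //; apply: sumr_ge0 => i _.
  exact: mean_ge0 fM f0.
Qed.

Section UltraLimits.
Context (U : set_system nat) (Uu : UltraFilter U).

(** Compactness gives a cluster point; an ultrafilter converges to each of its
    cluster points. *)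
Lemma cvg_ultra (M : R) (u : nat -> R) :
  (\forall N \near U, `|u N| <= M) -> cvg (u @ U).
Proof.
move=> uM.
have [p [_ pu]] : `[- M, M] `&` cluster (u @ U) !=set0.
  apply: (@segment_compact R (- M) M (u @ U)).
  by apply: filterS uM => N; rewrite ler_norml set_itvE.
apply: (@cvgP _ _ p) => B nB.
case: (@in_ultra_setVsetC _ U (u @^-1` B) Uu) => // nUB.
by have [y []] := pu (~` B) B nUB nB.
Qed.

Lemma is_mean_ulim (T : Type) (L : nat -> (T -> R) -> R) :
  (\forall N \near U, is_mean (L N)) ->
  is_mean (fun f => lim (L N f @[N --> U])).
Proof.
move=> mL.
have cL M f : bounded_by M f -> cvg (L N f @[N --> U]).
  move=> fM; apply: (@cvg_ultra `|M|).
  by apply: filterS mL => N mLN; exact: (mean_norm_le mLN fM).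
split.
- apply: lim_near_cst; first exact: norm_hausdorff.
  by apply: filterS mL => N mLN; exact: (mean_cst1 mLN).
- move=> M f g fM gM; apply: cvg_lim; first exact: norm_hausdorff.
  apply: (cvg_trans _ (cvgD (cL _ _ fM) (cL _ _ gM))).
  apply: near_eq_cvg; apply: filterS mL => N mL.
  by rewrite (meanD mL fM gM).
- move=> M k f fM; apply: cvg_lim; first exact: norm_hausdorff.
  apply: (cvg_trans _ (cvgMl_tmp (a := k) (cL _ _ fM))).
  apply: near_eq_cvg; apply: filterS mL => N mL.
  by rewrite (meanZ mL _ fM).
- move=> M f fM f0; apply: limr_ge; first exact: cL fM.
  by apply: filterS mL => N mLN; exact: (mean_ge0 mLN fM f0).
Qed.

End UltraLimits.
End Means.

(** * From means on 0-1 sequences to shift-invariant measures *)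

Definition bisequence := int -> bool.
HB.instance Definition _ := Pointed.on bisequence.

Definition agree (k : nat) (x y : bisequence) :=
  forall i : int, (`|i| <= k)%N -> x i = y i.

Definition cylinder : set (set bisequence) :=
  [set E | exists k, forall x y, agree k x y -> E x -> E y].

Lemma agree_sym k x y : agree k x y -> agree k y x.
Proof. by move=> xy i ik; rewrite xy. Qed.

Lemma agree_le k l x y : (k <= l)%N -> agree l x y -> agree k x y.
Proof. by move=> kl xy i ik; apply: xy; exact: leq_trans kl. Qed.

Lemma cylinder_coord (i : int) : cylinder [set x | x i].
Proof. by exists `|i|%N => x y /(_ i (leqnn _)) /= ->. Qed.

Lemma cylinder0 : cylinder set0.
Proof. by exists 0%N. Qed.

Lemma cylinderC E : cylinder E -> cylinder (~` E).
Proof.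
move=> [k kE]; exists k => x y /agree_sym xy nEx Ey.
by apply: nEx (kE _ _ xy Ey).
Qed.

Lemma cylinderU E F : cylinder E -> cylinder F -> cylinder (E `|` F).
Proof.
move=> [k kE] [l lF]; exists (maxn k l) => x y xy [Ex|Fx]; [left|right].
  by apply: kE Ex; apply: agree_le xy; exact: leq_maxl.
by apply: lF Fx; apply: agree_le xy; exact: leq_maxr.
Qed.

Lemma cylinderI E F : cylinder E -> cylinder F -> cylinder (E `&` F).
Proof.
move=> cE cF; rewrite -[_ `&` _]setCK setCI.
by apply/cylinderC/cylinderU; exact: cylinderC.
Qed.

HB.instance Definition _ := @isAlgebraOfSets.Build default_measure_display
  bisequence cylinder cylinder0 cylinderU cylinderC.

Definition shift (x : bisequence) : bisequence := fun i => x (i + 1).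
Definition unshift (x : bisequence) : bisequence := fun i => x (i - 1).

Lemma shiftK : cancel shift unshift.
Proof. by move=> x; apply/funext => i; rewrite /shift /unshift subrK. Qed.

Lemma unshiftK : cancel unshift shift.
Proof. by move=> x; apply/funext => i; rewrite /shift /unshift addrK. Qed.

Lemma iter_shiftE r (x : bisequence) i : iter r shift x i = x (i + r%:Z).
Proof.
elim: r i => [|r IH] i; first by rewrite addr0.
by rewrite iterS /shift IH -addrA -[1 in LHS]/(1%:Z) -PoszD add1n.
Qed.

Lemma cylinder_shift E : cylinder E -> cylinder (shift @^-1` E).
Proof.
move=> [k kE]; exists k.+1 => x y xy; apply: kE => i ik; apply: xy.
by lia.
Qed.

Lemma cylinder_unshift E : cylinder E -> cylinder (unshift @^-1` E).
Proof.
move=> [k kE]; exists k.+1 => x y xy; apply: kE => i ik; apply: xy.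
by lia.
Qed.

Lemma ultra_free : exists2 U : set_system nat, UltraFilter U & \oo `<=` U.
Proof.
by have [U [UU ooU]] := ultraFilterLemma eventually_filter; exists U.
Qed.

(** Compactness of the space of 0-1 sequences.  If no finite subfamily covers,
    choose points of [A] outside the first [n] sets; their coordinatewise limit
    along a free ultrafilter is in [A], and it agrees on any given window with
    infinitely many of the chosen points, so no [F m] can contain it. *)
Lemma cylinder_compact (A : set bisequence) (F : (set bisequence)^nat) :
  cylinder A -> (forall n, cylinder (F n)) -> A `<=` \bigcup_n F n ->
  exists n, A `<=` \big[setU/set0]_(k < n) F k.
Proof.
move=> [a aA] cF AF; apply: contrapT => /forallNP nAF.
have /choice[x Px] n : exists x, A x /\ ~ (\big[setU/set0]_(k < n) F k) x.
  by have /existsNP[x /not_implyP] := nAF n; exists x.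
have [U UU ooU] := ultra_free.
pose y : bisequence := fun i => `[< U [set n | x n i] >].
have xyi i : U [set n | x n i = y i].
  rewrite /y; case: asboolP => [|nU]; first exact: filterS.
  have [//|] := @in_ultra_setVsetC _ U [set n | x n i] UU.
  by apply: filterS => n /= /negP/negbTE.
have xy k : U [set n | agree k (x n) y].
  elim: k => [|k IH].
    by apply: filterS (xyi 0) => n xy0 i; rewrite leqn0 absz_eq0 => /eqP ->.
  apply: filterS (filterI IH (filterI (xyi k.+1%:Z) (xyi (- k.+1%:Z)))).
  move=> n [xyk [xyp xyn]] i.
  rewrite leq_eqVlt ltnS => /orP[/eqP ik|]; last exact: xyk.
  by case: (intP i) ik => [|m|m] //= [->].
have [n yn] := filter_ex (xy a).
have [m _ Fmy] := AF y (aA _ _ yn (Px n).1).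
have [k kF] := cF m.
have Um : U [set n | m < n]%N by apply: ooU; exists m.+1.
have [l [/agree_sym yl ml]] := filter_ex (filterI (xy k) Um).
apply: (Px l).2; rewrite -bigcup_mkord; exists m => //.
exact: kF Fmy.
Qed.

Section MeasureOfMean.
Context (R : realType) (L : (bisequence -> R) -> R) (mL : is_mean L).

(** The proof that [L] is a mean is an argument so that the content structure
    below can be attached to this constant. *)
Definition mean_content (h : is_mean L) (E : set bisequence) : \bar R :=
  (L \1_E)%:E.

Lemma mean_content_ge0 E : (0 <= mean_content mL E)%E.
Proof.
rewrite lee_fin; apply: (mean_ge0 mL (bounded_by_indic R E)) => x.
by rewrite indicE.
Qed.

Lemma mean_content_semi_additive :
  measure_function.semi_additive (mean_content mL).
Proof.
apply/additive2P.
  by rewrite /mean_content indic0 (mean_cst mL).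
move=> A B mA mB AB; rewrite /mean_content -EFinD; congr EFin.
rewrite -(meanD mL (bounded_by_indic R A) (bounded_by_indic R B)); congr L.
apply/funext => x /=; rewrite !indicE in_setU.
have : ~ (A `&` B) x by rewrite AB.
have [xA|/negbTE xA] := boolP (x \in A);
  have [xB|/negbTE xB] := boolP (x \in B) => //=;
  rewrite ?addr0 ?add0r// => nAB.
by exfalso; apply: nAB; split; apply: set_mem.
Qed.

HB.instance Definition _ := isContent.Build _ _ _ (mean_content mL)
  mean_content_ge0 mean_content_semi_additive.

(** By compactness a countable cover of a cylinder by cylinders has a finite
    subcover, so finite subadditivity suffices. *)
Lemma mean_content_sigma_subadditive :
  measurable_subset_sigma_subadditive (mean_content mL).
Proof.
move=> A F mF mA AF; have [n An] := cylinder_compact mA mF AF.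
apply: (le_trans (content_subadditive (mean_content mL)
  (fun k _ => mF k) mA An)).
rewrite -(big_mkord xpredT (fun k => mean_content mL (F k))).
exact: nneseries_lim_ge.
Qed.

HB.instance Definition _ := Content_SigmaSubAdditive_isMeasure.Build _ _ _
  (mean_content mL) mean_content_sigma_subadditive.

Definition shift_space := g_sigma_algebraType (@measurable _ bisequence).
Definition mean_measure : set shift_space -> \bar R :=
  measure_extension (mean_content mL).

HB.instance Definition _ := Measure.on mean_measure.

Lemma mean_measureE E : cylinder E -> mean_measure E = (L \1_E)%:E.
Proof.
by move=> cE; rewrite /mean_measure /measure_extension measurable_mu_extE.
Qed.

Lemma mean_measureT : mean_measure [set: shift_space] = 1%E.
Proof.
rewrite mean_measureE; last by exists 0%N.
by rewrite indicT (mean_cst1 mL).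
Qed.

HB.instance Definition _ := Measure_isProbability.Build _ _ _ mean_measure
  mean_measureT.

End MeasureOfMean.

Lemma cylinder_measurable E : cylinder E -> measurable (E : set shift_space).
Proof. by move=> cE; apply: sub_sigma_algebra. Qed.

Lemma measurable_shift :
  measurable_fun [set: shift_space] (shift : shift_space -> shift_space).
Proof.
apply: (@measurability _ _ shift_space shift_space _ _ cylinder) => //.
move=> _ [B cB <-]; rewrite setTI.
by apply: cylinder_measurable; exact: cylinder_shift.
Qed.

Lemma measurable_unshift :
  measurable_fun [set: shift_space] (unshift : shift_space -> shift_space).
Proof.
apply: (@measurability _ _ shift_space shift_space _ _ cylinder) => //.
move=> _ [B cB <-]; rewrite setTI.
by apply: cylinder_measurable; exact: cylinder_unshift.
Qed.

Section Invariance.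
Context (R : realType) (L : (bisequence -> R) -> R) (mL : is_mean L).
Hypothesis Lshift : forall M f, bounded_by M f -> L (f \o shift) = L f.

(** The extension is an infimum over countable covers by cylinders, and both
    the shift and its inverse transport covers to covers of the same cost. *)
Lemma mean_measure_shift (E : set shift_space) :
  mean_measure mL (shift @^-1` E) = mean_measure mL E.
Proof.
have le (s s' : bisequence -> bisequence) (Y : set bisequence) : cancel s s' ->
    (forall E, cylinder E -> cylinder (s @^-1` E)) ->
    (forall E, cylinder E -> L \1_(s @^-1` E) = L \1_E) ->
    (mean_measure mL (s @^-1` Y) <= mean_measure mL Y)%E.
  move=> sK cs Ls; apply: le_ereal_inf_tmp => _ [F [cF YF] <-].
  apply: ereal_inf_lbound; exists (fun n => s @^-1` F n).
    split=> [n|x /YF[n _ Fn]]; [exact: (cs _ (cF n))|by exists n].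
  by apply: eq_eseriesr => n _; rewrite /= /mean_content (Ls _ (cF n)).
have LE E' : L \1_(shift @^-1` E') = L \1_E'.
  by rewrite -(Lshift (bounded_by_indic R E')).
apply/eqP; rewrite eq_le; apply/andP; split.
  by apply: (le _ _ _ shiftK cylinder_shift) => E' _.
have := @le _ _ (shift @^-1` E) unshiftK cylinder_unshift.
rewrite -comp_preimage.
have -> : shift \o unshift = id by apply/funext => x; exact: unshiftK.
apply=> E' cE'; rewrite -LE -comp_preimage.
by have -> : unshift \o shift = id by apply/funext => x; exact: shiftK.
Qed.

Lemma mean_measure_preserving :
  invertible_measure_preserving (mean_measure mL)
    (shift : shift_space -> shift_space).
Proof.
split.
  split; first exact: measurable_shift.
  by move=> E _; exact: mean_measure_shift.
exists unshift; split.
- exact: shiftK.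
- exact: unshiftK.
- exact: measurable_unshift.
Qed.

End Invariance.

(** * Upper limits and the mean of a set of positive upper Banach density *)

Section Frequently.

Definition frequently (P : set nat) := forall n, exists2 m, (n <= m)%N & P m.

Lemma limn_esup_gt0 (R : realType) (u : nat -> \bar R) :
  (0 < limn_esup u)%E ->
  exists2 e : R, 0 < e & frequently [set n | (e%:E < u n)%E].
Proof.
move=> u0.
have [e e0 eu] : exists2 e : R, 0 < e & (e%:E < limn_esup u)%E.
  case: (limn_esup u) u0 => [r||]//; last by exists 1; rewrite ?ltr01 ?ltry.
  by rewrite lte_fin => r0; exists (r / 2); rewrite ?lte_fin; lra.
exists e => // n.
have nV : \oo [set k | n <= k]%N by exists n.
have : (limn_esup u <= ereal_sup (u @` [set k | n <= k]%N))%E.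
  by apply: ereal_inf_lbound; exists [set k | n <= k]%N.
by move=> /(lt_le_trans eu)/ereal_sup_gt[_ [m nm <-] em]; exists m.
Qed.

Lemma limn_esup_frequently_ge (R : realType) (u : nat -> \bar R) (e : \bar R) :
  frequently [set n | (e <= u n)%E] -> (e <= limn_esup u)%E.
Proof.
move=> eu; apply: le_ereal_inf_tmp => _ [V [n _ nV] <-].
have [m nm em] := eu n; apply: (le_trans em).
by apply: ereal_sup_ubound; exists m => //; apply: nV.
Qed.

(** A limit along such an ultrafilter only sees indices in [P], which replaces
    passing to a subsequence. *)
Lemma ultra_frequently P : frequently P ->
  exists2 U : set_system nat, UltraFilter U & \oo `<=` U /\ U P.
Proof.
move=> fP.
have PF : ProperFilter (within P \oo).
  split; last exact: within_filter.
  by move=> [n _ nP]; have [m nm Pm] := fP n; exact: nP m nm Pm.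
have [U [UU PU]] := ultraFilterLemma PF; exists U => //; split.
  by move=> V ooV; apply: PU; apply: filterS ooV => n Vn _.
by apply: PU; exists 0%N.
Qed.

Lemma frequently_ultra (U : set_system nat) P : UltraFilter U -> \oo `<=` U ->
  U P -> frequently P.
Proof.
move=> UU ooU UP n.
have Un : U [set k | n <= k]%N by apply: ooU; exists n.
by have [m [nm Pm]] := filter_ex (filterI Un UP); exists m.
Qed.

End Frequently.

Lemma card_finI_avg (R : realType) (T : choiceType) (B D : set T) :
  finite_set D ->
  (card_fin (B `&` D))%:R / (card_fin D)%:R = avg (fset_set D) (\1_B : T -> R).
Proof.
move=> fD; rewrite /avg /card_fin; congr (_ / _).
have -> : #|` fset_set (B `&` D)|%fset = size [seq x <- fset_set D | x \in B].
  rewrite cardfE -?cardfE; apply: perm_size; apply: uniq_perm.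
  - exact: fset_uniq.
  - by apply: filter_uniq; exact: fset_uniq.
  - move=> x; rewrite mem_filter !in_fset_set ?in_setI//.
    by apply: sub_finite_set fD => y [].
rewrite size_filter -sum1_count natr_sum big_mkcond /=.
by apply: eq_bigr => x _; rewrite indicE; case: (x \in B).
Qed.

Lemma perm_int_itv (a : int) (L : nat) :
  perm_eq (fset_set (int_itv a (a + L%:Z))) [seq a + i%:Z | i <- iota 0 L.+1].
Proof.
apply: uniq_perm; first exact: fset_uniq.
  by rewrite map_inj_uniq ?iota_uniq// => i j /addrI[].
move=> x; rewrite in_fset_set; last exact: finite_int_itv.
apply/idP/mapP => [|[i]].
  move=> /set_mem xab; have /andP[ax xb] : a <= x <= a + L%:Z by exact: xab.
  exists `|x - a|%N; last by lia.
  by rewrite mem_iota; lia.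
rewrite mem_iota => /andP[_ iL] ->; apply: mem_set; rewrite /int_itv /=; lia.
Qed.

Lemma size_int_itv (a b : int) : a < b ->
  (size (fset_set (int_itv a b)))%:Z = b - a + 1.
Proof.
move=> ab; have -> : b = a + `|b - a|%:Z by lia.
by rewrite (perm_size (perm_int_itv a _)) size_map size_iota; lia.
Qed.

(** The sum telescopes to two boundary terms. *)
Lemma avg_int_itv_shift (R : realType) (a b : int) M (f : int -> R) : a < b ->
  bounded_by M f ->
  `|avg (fset_set (int_itv a b)) (fun x => f (x + 1) - f x)|
    <= 2 * M / (b - a)%:~R.
Proof.
move=> ab fM; have -> : b = a + `|b - a|%:Z by lia.
set L := `|b - a|%N; have L0 : (0 < L)%N by rewrite /L; lia.
rewrite /avg (perm_size (perm_int_itv a L)) (perm_big _ (perm_int_itv a L)).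
rewrite size_map size_iota big_map -[iota 0 _]/(index_iota 0 L.+1).
rewrite (eq_bigr (fun i => f (a + i.+1%:Z) - f (a + i%:Z))); last first.
  by move=> i _; rewrite -addrA -PoszD addn1.
rewrite telescope_sumr// [a + _ - a]addrAC subrr add0r normrM normfV.
have M0 : 0 <= M by exact: le_trans (fM 0).
apply: ler_pM => //.
- by rewrite (le_trans (ler_normB _ _))// mulr2n mulrDl mul1r lerD.
- by rewrite normr_nat lef_pV2 ?posrE ?ltr0n// pmulrn ler_nat.
Qed.

(** Averages over intervals of density at least [e] in [A], passed to the limit
    along an ultrafilter that only sees those intervals.  Translation changes
    an average over a long interval by a boundary term that vanishes in the
    limit. *)
Lemma banach_mean (R : realType) (A : set int) :
  (0 < upper_banach_density R A)%E ->
  exists l : (int -> R) -> R, [/\ is_mean l,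
    forall M f k, bounded_by M f -> l (fun n => f (n + k)) = l f &
    0 < l \1_A].
Proof.
move=> /ereal_sup_gt[_ [a [b [abN ->]]]] /limn_esup_gt0[e e0 fe].
have [U UU [ooU Ue]] := ultra_frequently fe.
pose I N := fset_set (int_itv (a N) (b N)).
have abU K : \forall N \near U, K <= ((b N - a N)%:~R : R).
  by apply: ooU; move/cvgryPge : abN => /(_ K).
have abU0 : \forall N \near U, a N < b N.
  by apply: filterS (abU 1) => N; rewrite ler1z; lia.
pose l (f : int -> R) := lim (avg (I N) f @[N --> U]).
have mN : \forall N \near U, is_mean (fun f : int -> R => avg (I N) f).
  apply: filterS abU0 => N ab.
  apply: (is_mean_avg (L := fun x (f : int -> R) => f x)) => [|i].
    by rewrite -ltz_nat (size_int_itv ab); lia.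
  exact: is_mean_eval.
have ml : is_mean l by exact: is_mean_ulim mN.
have l1 M f : bounded_by M f -> l (fun n => f (n + 1)) = l f.
  move=> fM; have fM1 : bounded_by M (fun n => f (n + 1)).
    by move=> x; exact: fM.
  apply/eqP; rewrite -subr_eq0 -(meanB ml fM1 fM).
  apply/eqP; apply: cvg_lim; first exact: norm_hausdorff.
  apply/cvgr0Pnorm_le => d d0.
  apply: filterS (filterI abU0 (abU (2 * M / d))) => N [ab dN].
  apply: (le_trans (avg_int_itv_shift ab fM)).
  have ba0 : 0 < ((b N - a N)%:~R : R) by rewrite ltr0z; lia.
  by rewrite ler_pdivrMr// [d * _]mulrC -ler_pdivrMr.
have lnat (k : nat) M f : bounded_by M f -> l (fun n => f (n + k%:Z)) = l f.
  move=> fM; elim: k => [|k IH].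
    by congr l; apply/funext => n; rewrite addr0.
  rewrite -IH -(l1 M (fun n => f (n + k%:Z))); last by move=> x; exact: fM.
  by congr l; apply/funext => n; congr f; lia.
exists l; split=> // [M f k fM|].
  have [m [->|->]] : exists m : nat, k = m%:Z \/ k = - m%:Z.
    by exists `|k|%N; lia.
    exact: lnat fM.
  rewrite -(lnat m M (fun n => f (n - m%:Z))); last by move=> x; exact: fM.
  by congr l; apply/funext => n; congr f; lia.
apply: (lt_le_trans e0); apply: limr_ge.
  apply: (cvg_ultra UU (M := 1)); apply: filterS mN => N mN.
  by have := mean_norm_le mN (bounded_by_indic R A); rewrite normr1.
apply: filterS Ue => N.
rewrite /= lte_fin card_finI_avg; last exact: finite_int_itv.
exact: ltW.
Qed.

(** * A point that visits the given events with positive frequency *)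

Lemma avg_norm_le (R : realType) (I : Type) (s : seq I) M (f : I -> R) :
  0 <= M -> bounded_by M f -> `|avg s f| <= M.
Proof.
move=> M0 fM; have [s0|s0] := posnP (size s).
  by rewrite /avg (size0nil s0) big_nil mul0r normr0.
have := mean_norm_le (is_mean_avg s0 (fun i => @is_mean_eval R I i)) fM.
by rewrite (ger0_norm M0).
Qed.

Lemma avg_indic_local (R : realType) (I : Type) (s : seq I)
    (E : I -> set bisequence) :
  (forall i, cylinder (E i)) ->
  exists k, forall x y, agree k x y ->
    avg s (fun i => \1_(E i) x : R) = avg s (fun i => \1_(E i) y).
Proof.
move=> cE; rewrite /avg.
suff [k kP] : exists k, forall x y, agree k x y ->
    \sum_(i <- s) (\1_(E i) x : R) = \sum_(i <- s) \1_(E i) y.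
  by exists k => x y /kP ->.
elim: s => [|i s [k IH]]; first by exists 0%N => x y _; rewrite !big_nil.
have [l lE] := cE i; exists (maxn k l) => x y xy; rewrite !big_cons.
have xyl : agree l x y by apply: agree_le xy; exact: leq_maxr.
rewrite (IH x y); last by apply: agree_le xy; exact: leq_maxl.
congr (_ + _); rewrite !indicE; congr (_%:R); congr nat_of_bool.
by apply/idP/idP; rewrite !inE; apply: lE => //; exact: agree_sym.
Qed.

(** The law of [p t], for [t] distributed according to the mean [l], is carried
    by limits of the points [p t].  In the section, [f N x] is the proportion of
    indices of [s N] whose event contains [x], [F N] the event that this
    proportion is at least [d / 2], and [G k] the set of sequences whose
    restriction to the window of radius [k] is not that of any [p t]. *)
Section LimsupPoint.
Context (R : realType) (T : Type) (l : (T -> R) -> R) (ml : is_mean l).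
Context (p : T -> bisequence).
Context (J : Type) (s : nat -> seq J) (E : J -> set bisequence).
Hypothesis cE : forall j, cylinder (E j).
Context (d : R) (d0 : 0 < d).

Let f N x : R := avg (s N) (fun j => \1_(E j) x).
Let F N : set bisequence := [set x | d / 2 <= f N x].
Let G k : set bisequence := [set x | forall t, ~ agree k x (p t)].

Let f_bounded N : bounded_by 1 (f N).
Proof. by move=> x; apply: avg_norm_le => // j; exact: bounded_by_indic. Qed.

Let cylinder_F N : cylinder (F N).
Proof.
have [k kf] := avg_indic_local R (s N) cE.
by exists k => x y xy; rewrite /F /f /= (kf _ _ xy).
Qed.

Let cylinder_G k : cylinder (G k).
Proof.
exists k => x y xy Gx t yt; apply: (Gx t) => i ik.
by rewrite (xy i ik) (yt i ik).
Qed.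

Let L h := l (h \o p).
Let mL : is_mean L. Proof. exact: is_mean_comp. Qed.

Let mean_G k : L \1_(G k) = 0.
Proof.
rewrite -[RHS](mean_cst ml); congr l; apply/funext => t /=.
by rewrite indicE memNset// => /(_ t); apply.
Qed.

Let mean_f N : L (f N) = avg (s N) (fun j => l \1_(p @^-1` E j)).
Proof.
have b j : bounded_by 1 (\1_(E j) : bisequence -> R) by exact: bounded_by_indic.
rewrite /avg -(mean_sum mL (s N) b) mulrC -(meanZ mL _ (M := (size (s N))%:R)).
  by congr L; apply/funext => x; rewrite /f /avg mulrC.
move=> x; elim: (s N) => [|j t IH]; first by rewrite big_nil normr0.
by rewrite big_cons (le_trans (ler_normD _ _))//= -natr1 addrC lerD//; exact: b.
Qed.

(** Markov: [f N] is at most the indicator of [F N] plus [d / 2]. *)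
Let mean_F N :
  d <= avg (s N) (fun j => l \1_(p @^-1` E j)) -> d / 2 <= L \1_(F N).
Proof.
rewrite -mean_f => dN; have d_gt0 := d0.
have bd : bounded_by (1 + d) (cst (d / 2) : bisequence -> R).
  by move=> x /=; rewrite ger0_norm; lra.
have bF : bounded_by (1 + d) (\1_(F N) : bisequence -> R).
  by apply: bounded_by_le (bounded_by_indic R _); lra.
have bFd : bounded_by (1 + d + (1 + d))
    (\1_(F N) \+ cst (d / 2) : bisequence -> R).
  by move=> x /=; apply: (le_trans (ler_normD _ _)); exact: lerD (bF x) (bd x).
have bf : bounded_by (1 + d + (1 + d)) (f N).
  by apply: bounded_by_le (f_bounded N); lra.
suff : L (f N) <= L \1_(F N) + d / 2 by lra.
rewrite -[X in _ + X](mean_cst mL) -(meanD mL bF bd).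
apply: (mean_le mL bf bFd) => x /=; rewrite indicE.
have [xF|] := boolP (x \in F N).
  by have := f_bounded N x; rewrite ler_norml => /andP[_]; rewrite mulr1n; lra.
by rewrite add0r notin_setE => /negP; rewrite -ltNge => /ltW.
Qed.

(** A form of Fatou's lemma: events of measure at least [d / 2] have an upper
    limit of measure at least [d / 2], which cannot be covered by the null sets
    [G k]. *)
Lemma exists_limsup_point :
  frequently [set N | d <= avg (s N) (fun j => l \1_(p @^-1` E j))] ->
  exists x, (forall k, exists t, agree k x (p t)) /\
    frequently [set N | d / 2 <= avg (s N) (fun j => \1_(E j) x)].
Proof.
set P := [set N | _] => fP; have d_gt0 := d0.
(* Only the indices in [P] carry an event of large measure; the others are
   discarded by making their event empty. *)
pose H N : set shift_space := [set x | P N /\ F N x].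
have cH N : cylinder (H N).
  have [k kF] := cylinder_F N.
  by exists k => x y xy [PN Fx]; split=> //; exact: kF Fx.
pose mu := mean_measure mL.
have mH N : measurable (H N) by exact: cylinder_measurable.
have mHn n : measurable (\bigcup_(k >= n) H k) by exact: bigcup_measurable.
have muH n : ((d / 2)%:E <= mu (\bigcup_(k >= n) H k))%E.
  have [N nN PN] := fP n.
  apply: (@le_trans _ _ (mu (H N))); last first.
    by apply: le_measure; rewrite ?inE//; exact: bigcup_sup.
  rewrite /mu mean_measureE// lee_fin (_ : H N = F N); first exact: mean_F.
  by apply/seteqP; split=> [x []|x].
have mulim : ((d / 2)%:E <= mu (lim_sup_set H))%E.
  apply: (cvge_to_ge (lim_sup_set_cvg mu H mH _)); last exact: nearW.
  by apply: (le_lt_trans (probability_le1 _ _)); rewrite ?ltry.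
apply: contrapT => nx.
suff : (mu (lim_sup_set H) <= 0)%E.
  by move=> /(le_trans mulim); rewrite lee_fin; lra.
have mG k : measurable (G k : set shift_space) by exact: cylinder_measurable.
have HG : lim_sup_set H `<=` \bigcup_k G k.
  move=> x Hx; apply: contrapT => nGx; apply: nx; exists x; split=> [k|n].
    apply: contrapT => nt; apply: nGx; exists k => // t xt; apply: nt.
    by exists t.
  by have [N nN [_ FN]] := Hx n I; exists N.
have mlim : measurable (lim_sup_set H) by apply: bigcap_measurable.
have := @measure_sigma_subadditive _ _ _ mu (lim_sup_set H) G mG mlim HG.
move=> /le_trans; apply.
rewrite eseries0// => k _ _.
by rewrite /= /mu mean_measureE// mean_G.
Qed.

End LimsupPoint.

(** * Recurrence on average along dilated sequences *)

Section AveragedRecurrence.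
Context (R : realType) (A : set int) (l : (int -> R) -> R).
Hypothesis ml : is_mean l.
Hypothesis l_shift : forall M f k, bounded_by M f ->
  l (fun n => f (n + k)) = l f.
Hypothesis lA : 0 < l \1_A.
Context (U : set_system nat) (UU : UltraFilter U) (s : nat -> seq int).
Hypothesis s_gt0 : \forall N \near U, (0 < size (s N))%N.

Let code (c n : int) : bisequence := fun i => n + c * i \in A.

Let L (f : bisequence -> R) :=
  lim (avg (s N) (fun c => l (f \o code c)) @[N --> U]).

Let mL : is_mean L.
Proof.
apply: is_mean_ulim; apply: filterS s_gt0 => N sN.
apply: (is_mean_avg (L := fun c f => l (f \o code c))) => // c.
exact: is_mean_comp.
Qed.

(** The shift moves [code c n] to [code c (n + c)], and [l] does not notice the
    translation of [n] by [c]. *)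
Let L_shift M f : bounded_by M f -> L (f \o shift) = L f.
Proof.
move=> fM; rewrite /L; congr (lim (_ @ U)); apply/funext => N.
congr avg; apply/funext => c.
rewrite -(@l_shift M (f \o code c) c); last exact: bounded_by_comp.
congr l; apply/funext => n /=; congr f; apply/funext => i.
by rewrite /shift /code mulrDr mulr1 addrA addrAC.
Qed.

(** Correlations along a sequence of steps [c], one system for each [c], are
    averaged into the correlations of a single shift-invariant measure, to which
    measurable recurrence applies.  This produces one [r] that works for a
    positive proportion of the [c], however sparse the averaged sets are. *)
Lemma averaged_recurrence (S : set nat) : measurable_recurrence R S ->
  exists2 r, S r & 0 < lim (avg (s N) (fun c =>
    l \1_[set n | A n /\ A (n + c * r%:Z)]) @[N --> U]).
Proof.
move=> [_ recS]; pose Y : set shift_space := [set x : bisequence | x 0].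
have cY : cylinder Y := cylinder_coord 0.
have [|r Sr] := recS _ _ _ _ (mean_measure_preserving mL L_shift) Y
  (cylinder_measurable cY).
  rewrite /= mean_measureE// lte_fin.
  suff -> : L \1_Y = l \1_A by [].
  apply: lim_near_cst; first exact: norm_hausdorff.
  apply: filterS s_gt0 => N sN.
  rewrite -[RHS](mean_cst (is_mean_avg sN (fun i => @is_mean_eval R _ i))).
  congr avg; apply/funext => c /=; congr l; apply/funext => n /=.
  rewrite !indicE; congr (_%:R); congr nat_of_bool.
  by apply/idP/idP => [/set_mem|An]; [|apply: mem_set];
    rewrite /Y/= /code mulr0 addr0.
have -> : Y `&` iter r shift @^-1` Y =
    [set x : bisequence | x 0] `&` [set x : bisequence | x r%:Z].
  by apply/seteqP; split => x [x0]; rewrite /Y /= iter_shiftE add0r.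
rewrite /= mean_measureE; last first.
  by apply: cylinderI; exact: cylinder_coord.
rewrite lte_fin => Lr; exists r => //.
apply: (lt_le_trans Lr); rewrite le_eqVlt; apply/orP; left; apply/eqP.
rewrite /L; congr (lim (_ @ U)); apply/funext => N.
congr avg; apply/funext => c; congr l; apply/funext => n.
rewrite /= !indicE; congr (_%:R); congr nat_of_bool.
apply/idP/idP => /set_mem H; apply: mem_set; move: H;
  rewrite /code /= mulr0 addr0.
  by move=> [/set_mem An /set_mem Anr].
by move=> [An Anr]; split; exact: mem_set.
Qed.

End AveragedRecurrence.

(** * The sumset in the difference set *)

Theorem proposition1p40 (R : realType) (C S A : set nat)
  (C_pos : positive_naturals C) (C_inf : infinite_set C)
  (S_rec : measurable_recurrence R S)
  (A_pos : positive_naturals A)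
  (A_dens : (0 < upper_banach_density R (Posz @` A))%E) :
  exists r : nat, S r /\
  exists B : set nat,
    [/\ B `<=` C,
        (0 < upper_relative_density R C B)%E &
        Posz @` (scaled_sumset r B) `<=` difference_set A].
Proof.
have [l [ml l_shift lA]] := banach_mean A_dens.
set Z := Posz @` A in l_shift lA *.
have [U UU ooU] := ultra_free.
pose D N := C `&` initial_segment N.
have fD N : finite_set (D N).
  by apply: sub_finite_set (finite_initial_segment N); exact: subIsetr.
pose s N : seq nat := fset_set (D N).
(* The step is [2 c]: the points [n + r c] and [n - r c] are [2 c r] apart. *)
pose s2 N : seq int := [seq 2 * c%:Z | c <- s N].
have s2_gt0 : \forall N \near U, (0 < size (s2 N))%N.
  have [c Cc] : C !=set0.
    apply/set0P/negP => /eqP C0; apply: C_inf.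
    by rewrite C0; exact: finite_set0.
  apply: ooU; exists c => // N /= cN.
  rewrite size_map -has_predT; apply/hasP; exists c => //.
  by rewrite in_fset_set// inE; split=> //; rewrite /initial_segment /= C_pos.
have [r Sr] := averaged_recurrence ml l_shift lA UU s2_gt0 S_rec.
set g := lim _; rewrite -/g => g0; exists r; split=> //.
pose p (n : int) : bisequence := fun i => n + i \in Z.
pose E (c : nat) : set bisequence :=
    [set x : bisequence | x (r * c)%:Z] `&`
    [set x : bisequence | x (- (r * c)%:Z)].
have cE c : cylinder (E c) by apply: cylinderI; exact: cylinder_coord.
(* Translation by [- r c] turns the pair [n], [n + 2 c r] into
   [n - r c], [n + r c], that is, into the coordinates [- r c] and [r c] of
   the translate [p n]. *)
have avgE N : avg (s2 N) (fun c => l \1_[set n | Z n /\ Z (n + c * r%:Z)]) =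
    avg (s N) (fun c => l \1_(p @^-1` E c)).
  rewrite /avg size_map big_map; congr (_ / _); apply: eq_bigr => c _.
  rewrite -(l_shift 1 _ (- (r * c)%:Z)) ; last exact: bounded_by_indic.
  congr l; apply/funext => n; rewrite !indicE; congr (_%:R); congr nat_of_bool.
  have e : n - (r * c)%:Z + 2 * c%:Z * r = n + (r * c)%:Z.
    by rewrite PoszM; lia.
  apply/idP/idP => /set_mem H; apply: mem_set; move: H; rewrite /E /p /= e.
    by move=> [zn zp]; split; exact: mem_set.
  by move=> [/set_mem zn /set_mem zp].
have fq : frequently [set N | g / 2 <= avg (s N) (fun c => l \1_(p @^-1` E c))].
  apply: (frequently_ultra UU ooU).
  have cg : cvg (avg (s2 N)
      (fun c => l \1_[set n | Z n /\ Z (n + c * r%:Z)]) @[N --> U]).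
    apply: (cvg_ultra UU (M := 1)); near=> N; apply: avg_norm_le => // c.
    rewrite -[leRHS]normr1; apply: (mean_norm_le ml).
    exact: bounded_by_indic.
  have gg : g / 2 < g by lra.
  have /(_ _ _ gg) := cvgr_ge g cg; apply: filterS => N /=.
  by rewrite avgE.
have g20 : 0 < g / 2 by lra.
have [x [xp fx]] := exists_limsup_point ml cE g20 fq.
exists (C `&` [set c | E c x]); split; first exact: subIsetl.
  apply: (@lt_le_trans _ _ (g / 2 / 2)%:E); first by rewrite lte_fin; lra.
  apply: limn_esup_frequently_ge => n; have [N nN gN] := fx n; exists N => //=.
  rewrite lee_fin [C `&` _]setIC -setIA card_finI_avg//.
  exact: fD.
move=> _ [_ [b [Cb [xb _]] [b' [Cb' [_ xb']] <-]] <-].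
(* A window of this radius contains both coordinates [r b] and [- r b']. *)
have [n nx] := xp (r * b + r * b')%N.
have : p n (r * b)%:Z by rewrite -(nx _)//; lia.
have : p n (- (r * b')%:Z) by rewrite -(nx _)//; lia.
rewrite /p => /set_mem[a' Aa' a'E] /set_mem[a Aa aE].
exists a => //; exists a' => //; rewrite a'E aE mulnDr; lia.
Unshelve. all: by end_near. Qed.
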